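(* Let $x$ be an element of a Banach algebra and let $K$ be a compact subset of the closed disc $\overline{D}(0,r(x))=\{\lambda\in\mathbb{C}:|\lambda|\le r(x)\}$. Then there exist a Banach algebra $B$ and an element $y\in B$ such that $\lVert y^n\rVert=\lVert x^n\rVert$ for all integers $n\geq 0$ and $\sigma(y)=\sigma(x)\cup K$.
   Context: Banach algebras are complex and unital, with submultiplicative norm and $\lVert 1\rVert=1$. $\sigma(x)=\{\lambda\in\mathbb{C}:\lambda\cdot 1-x\text{ is not invertible}\}$ is the spectrum of $x$ and $r(x)=\sup\{|\lambda|:\lambda\in\sigma(x)\}$ is its spectral radius. *)

(* Defs.v *)
From HB Require Import structures.
From mathcomp Require Import all_boot all_order all_algebra.
From mathcomp Require Import all_classical all_reals.
From mathcomp Require Import topology normedtype.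
From mathcomp Require Export complex.

Set Implicit Arguments.
Unset Strict Implicit.
Unset Printing Implicit Defensive.

Import Order.TTheory GRing.Theory Num.Theory.
Import numFieldNormedType.Exports.

Local Open Scope classical_set_scope.
Local Open Scope ring_scope.
Local Open Scope complex_scope.

(* A joint HB structure of normed module and algebra is impossible, since
   [Num.NumDomain] already joins rings and norms.  A normed algebra is thus an
   algebra with its own norm [alg_norm], from which its carrier receives the
   library's normed module structure, with norm [`|a| := alg_norm a].  As for
   any [normedModType K], the norm takes its values in K. *)
HB.mixin Record Algebra_isNormedAlgebra (K : numFieldType) A
    & GRing.Algebra K A := {
  alg_norm : A -> K;
  ler_alg_normD : forall a b : A, alg_norm (a + b) <= alg_norm a + alg_norm b;
  alg_normZ : forall (k : K) (a : A), alg_norm (k *: a) = `|k| * alg_norm a;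
  alg_norm0_eq0 : forall a : A, alg_norm a = 0 -> a = 0;
  ler_alg_normM : forall a b : A, alg_norm (a * b) <= alg_norm a * alg_norm b;
  alg_norm1 : alg_norm 1 = 1
}.

#[short(type="normedAlgType")]
HB.structure Definition NormedAlgebra (K : numFieldType) :=
  {A of GRing.Algebra K A & Algebra_isNormedAlgebra K A}.

HB.instance Definition _ (K : numFieldType) (A : normedAlgType K) :=
  Lmodule_isNormed.Build K (NormedAlgebra.sort A)
    (@ler_alg_normD K A) (@alg_normZ K A) (@alg_norm0_eq0 K A).

Definition complete_norm (K : numFieldType) (A : normedAlgType K) : Prop :=
  forall F : set_system A, ProperFilter F -> cauchy F -> cvg F.

HB.mixin Record NormedAlgebra_isBanachAlgebra (K : numFieldType) A
    & NormedAlgebra K A := {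
  banach_complete : complete_norm A
}.

#[short(type="banachAlgType")]
HB.structure Definition BanachAlgebra (K : numFieldType) :=
  {A of NormedAlgebra K A & NormedAlgebra_isBanachAlgebra K A}.

HB.instance Definition _ (K : numFieldType) (A : banachAlgType K) :=
  NormedModule.copy (BanachAlgebra.sort A) (NormedAlgebra.sort A).

#[non_forgetful_inheritance]
HB.instance Definition _ (K : numFieldType) (A : banachAlgType K) :=
  Uniform_isComplete.Build (BanachAlgebra.sort A) (@banach_complete K A).

Section Spectrum.
Variables (R : realType) (A : banachAlgType R[i]).

Definition invertible (a : A) : Prop := exists b : A, b * a = 1 /\ a * b = 1.

Definition spectrum (x : A) : set R[i] :=
  [set l : R[i] | ~ invertible (l *: 1 - x)].

(* [complex.Re] only casts the real number `|l| : R[i] to R. *)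
Definition spectral_radius (x : A) : R :=
  sup [set complex.Re `|l| | l in spectrum x].

End Spectrum.

(* Not [closed_ball], the closure of an open ball, which is empty when r = 0. *)
Definition closed_disc (R : realType) (c : R[i]) (r : R) : set R[i] :=
  [set l : R[i] | `|l - c| <= r%:C].

(* Main.v *)
Require Import Defs.
From mathcomp Require Import all_boot all_order all_algebra.
From mathcomp Require Import all_classical all_reals.
From mathcomp Require Import topology normedtype sequences.
From mathcomp Require Import ring.
From HB Require Import structures.

Set Implicit Arguments.
Unset Strict Implicit.

(** Adjoin to [x] all scalars of [K] at once.  Let [B] be the algebra of bounded
    families of elements of [A] indexed by [K] and one extra point, with the
    supremum norm, and let [y] be the family whose value is [x] at the extra
    point and [k *: 1] at each [k] in [K].

    The norms agree because [y ^+ n] is [x ^+ n] at the extra point and has norm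
    [`|k| ^+ n] at [k], which is at most [r(x) ^ n <= `|x ^+ n|].  That last
    bound ([expr_spectral_radius_le]) follows from [spectrumX] and from
    [spectrum_norm_le], which rests on the Neumann series.

    A family is invertible in [B] if and only if its values have inverses whose
    norms are uniformly bounded ([invertible_linftyP]).  Hence [spectrum y]
    contains [spectrum x] and [K].  Conversely, if [l] lies in neither set, the
    inverse of [l - k] has norm at most [1 / d], where [d > 0] is a lower
    bound for the distances from [l] to the points of [K]; there is one because
    [K] is closed ([compact_dist_gt0]).

    Bounded families do the work of the product of [A] with the continuous
    functions on [K]: no continuity has to be carried along, and the extra
    point keeps the index set, hence [B], nontrivial when [K] is empty. *)

Import Order.TTheory GRing.Theory Num.Theory.
Import numFieldNormedType.Exports.

Local Open Scope classical_set_scope.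
Local Open Scope ring_scope.
Local Open Scope complex_scope.

(** * Invertibility and the spectrum in a Banach algebra *)

(** The norm takes its values in [R[i]], whereas suprema and the Archimedean
    property live in [R]; this moves nonnegative numbers from one to the
    other. *)
Lemma ge0_complexP (R : realType) (q : R[i]) :
  0 <= q -> exists2 r : R, 0 <= r & q = r%:C.
Proof.
move=> q0; exists (complex.Re q); last by rewrite RRe_real// ger0_real.
by rewrite -ler0c RRe_real// ger0_real.
Qed.

Lemma complex_exprn_lt (R : realType) (q e : R[i]) :
  0 <= q -> q < 1 -> 0 < e -> exists N, q ^+ N < e.
Proof.
move=> /ge0_complexP[r r0 ->] r1 e0.
have [d d0 eE] := ge0_complexP (ltW e0).
move: r1 e0; rewrite {}eE ltcR (ltcR 0) => r1 {}d0.
have r1' : `|r| < 1 by rewrite ger0_norm.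
have /cvgrPdist_lt/(_ d d0)[N _ /(_ N (leqnn N))] := cvg_expr r1'.
rewrite /= sub0r normrN ger0_norm ?exprn_ge0// => rN.
by exists N; rewrite -rmorphXn ltcR.
Qed.

Section BanachAlgebraSpectrum.
Variables (R : realType) (A : banachAlgType R[i]).
Implicit Types (a b x : A) (l : R[i]).

Lemma normM_le a b : `|a * b| <= `|a| * `|b|.
Proof. exact: ler_alg_normM. Qed.

Lemma norm1_eq1 : `|1 : A| = 1.
Proof. exact: alg_norm1. Qed.

Lemma normX_le a n : `|a ^+ n| <= `|a| ^+ n.
Proof.
elim: n => [|n IHn]; first by rewrite !expr0 norm1_eq1.
rewrite !exprS (le_trans (normM_le _ _))// ler_wpM2l//.
Qed.

Lemma norm_geometric_sum a n : `|a| < 1 ->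
  `|\sum_(i < n) a ^+ i| <= (1 - `|a|)^-1.
Proof.
move=> a1; have a1' : 0 < 1 - `|a| by rewrite subr_gt0.
apply: (@le_trans _ _ (\sum_(i < n) `|a| ^+ i)).
  rewrite (le_trans (ler_norm_sum _ _ _))// ler_sum// => i _.
  exact: normX_le.
rewrite -[leRHS]mul1r ler_pdivlMr// mulrC.
have -> : (1 - `|a|) * \sum_(i < n) `|a| ^+ i = 1 - `|a| ^+ n.
  by apply/eqP; rewrite -eqr_opp opprB subrX1 -mulNr opprB.
by rewrite gerBl exprn_ge0.
Qed.

Lemma geometric_sum_cvg a : `|a| < 1 ->
  cvg ((fun n => \sum_(i < n) a ^+ i) @ \oo).
Proof.
move=> a1; have a1' : 0 < 1 - `|a| by rewrite subr_gt0.
apply: (banach_complete _); apply: cauchy_exP => e e0.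
have [N Ne] := complex_exprn_lt (normr_ge0 a) a1 (mulr_gt0 e0 a1').
exists (\sum_(i < N) a ^+ i); exists N => //= n /= /subnKC <-.
rewrite -ball_normE /= distrC big_split_ord /= addrAC subrr add0r.
under eq_bigr do rewrite exprD.
rewrite -mulr_sumr (le_lt_trans (normM_le _ _))//.
apply: (@le_lt_trans _ _ (`|a| ^+ N * (1 - `|a|)^-1)).
  by apply: ler_pM => //; [exact: normX_le|exact: norm_geometric_sum].
by rewrite ltr_pdivrMr.
Qed.

Lemma norm_lt_all_eq0 a : (forall e : R[i], 0 < e -> `|a| < e) -> a = 0.
Proof.
move=> ae; apply/eqP; apply: contraT; rewrite -normr_gt0 => /ae.
by rewrite ltxx.
Qed.

(** The sum [s] of the geometric series of [a] is the inverse.  Consecutive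
    partial sums satisfy [s2 = 1 + a * s1 = 1 + s1 * a], and both tend to [s],
    so [s] solves the limiting equations [s = 1 + a * s = 1 + s * a]. *)
Lemma invertible_1B a : `|a| < 1 -> invertible (1 - a).
Proof.
move=> a1; have /cvg_ex[s /cvgrPdist_lt sP] := geometric_sum_cvg a1.
have approx (e : R[i]) : 0 < e ->
    exists s1 s2, [/\ `|s - s1| < e / 2, `|s - s2| < e / 2,
      s2 = 1 + a * s1 & s2 = 1 + s1 * a].
  move=> e0; have [N _ NP] := sP _ (divr_gt0 e0 (ltr0n _ 2)).
  exists (\sum_(i < N) a ^+ i).
  exists (\sum_(i < N.+1) a ^+ i).
  split; [exact: (NP N) (leqnn N)|by apply: (NP N.+1); rewrite /= leqnSn| |];
    rewrite big_ord_recl expr0; congr (1 + _).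
    by rewrite mulr_sumr; apply: eq_bigr => i _; rewrite -exprS.
  by rewrite mulr_suml; apply: eq_bigr => i _; rewrite -exprSr.
exists s; split; apply/eqP; rewrite -subr_eq0; apply/eqP.
  apply: norm_lt_all_eq0 => e /approx[s1 [s2 [s1e s2e _ s2E]]].
  have -> : s * (1 - a) - 1 = (s - s2) - (s - s1) * a.
    by rewrite s2E mulrBr mulr1 mulrBl opprB opprD !addrA addrNK addrAC.
  rewrite (le_lt_trans (ler_normB _ _))// [e]splitr ltrD//.
  rewrite (le_lt_trans (normM_le _ _))// (le_lt_trans _ s1e)//.
  by rewrite ler_piMr// ltW.
apply: norm_lt_all_eq0 => e /approx[s1 [s2 [s1e s2e s2E _]]].
have -> : (1 - a) * s - 1 = (s - s2) - a * (s - s1).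
  by rewrite s2E mulrBr mulrBl mul1r opprB opprD !addrA addrNK addrAC.
rewrite (le_lt_trans (ler_normB _ _))// [e]splitr ltrD//.
rewrite (le_lt_trans (normM_le _ _))// (le_lt_trans _ s1e)//.
by rewrite ler_piMl// ltW.
Qed.

Lemma invertibleZ l a : l != 0 -> invertible a -> invertible (l *: a).
Proof.
move=> l0 [b [ba ab]]; exists (l^-1 *: b).
by rewrite -!scalerAl -!scalerAr !scalerA mulVf// mulfV// !scale1r.
Qed.

(** If [c] inverts [a * b], then [c * b] is a left inverse of [a] and [b * c] a
    right inverse, so they coincide. *)
Lemma invertible_factor a b : GRing.comm a b -> invertible (a * b) ->
  invertible a.
Proof.
move=> ab [c [cab abc]]; have cba : c * b * a = 1 by rewrite -mulrA -ab.
exists (c * b); split=> //.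
have -> : c * b = b * c.
  by rewrite -[LHS]mulr1 -abc -(mulrA a) (mulrA _ a) cba mul1r.
by rewrite mulrA.
Qed.

Lemma spectrum_norm_le l a : spectrum a l -> `|l| <= `|a|.
Proof.
move=> la; rewrite real_leNgt ?normr_real//; apply/negP => al.
have l0 : l != 0 by rewrite -normr_gt0 (le_lt_trans _ al).
apply: la; have -> : l *: 1 - a = l *: (1 - l^-1 *: a).
  by rewrite scalerBr scalerA mulfV// scale1r.
apply/invertibleZ/invertible_1B => //.
by rewrite normrZ normfV mulrC ltr_pdivrMr ?mul1r// normr_gt0.
Qed.

(** This is the easy inclusion of the spectral mapping theorem for powers:
    [l - a] is a factor of [l ^+ n - a ^+ n], with a commuting cofactor. *)
Lemma spectrumX l a n : spectrum a l -> spectrum (a ^+ n) (l ^+ n).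
Proof.
move=> la aln; apply: la; move: aln.
rewrite -[1 in X in invertible X](expr1n _ n) -exprZn.
have la_comm : GRing.comm (l *: 1) a.
  by rewrite /GRing.comm -scalerAl -scalerAr mul1r mulr1.
rewrite subrXX_comm//; apply: invertible_factor.
apply: commr_sum => i _; apply: commrM; apply: commrX.
  by apply/commr_sym; apply: commrB => //; exact: commr_refl.
by apply/commr_sym; apply: commrB; [exact/commr_sym|exact: commr_refl].
Qed.

(** The hypothesis [0 <= c] covers an empty spectrum, whose supremum is 0. *)
Lemma spectral_radius_le a (c : R) : 0 <= c ->
  (forall l, spectrum a l -> `|l| <= c%:C) -> spectral_radius a <= c.
Proof.
move=> c0 ac; rewrite /spectral_radius; set S := (X in sup X).
have [->|S0] := eqVneq S set0; first by rewrite sup0.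
apply: ge_sup; first exact/set0P.
by move=> _ [l /ac lc <-]; rewrite -lecR RRe_real// normr_real.
Qed.

(** Each [m] in the spectrum of [a] satisfies [`|m| ^+ n <= `|a ^+ n|], by
    [spectrumX] and [spectrum_norm_le].  So for [n > 0] the [n]-th root of
    [`|a ^+ n|] bounds the spectrum, hence the spectral radius. *)
Lemma expr_spectral_radius_le a l n :
  `|l| <= (spectral_radius a)%:C -> `|l| ^+ n <= `|a ^+ n|.
Proof.
move=> lr; case: n => [|n]; first by rewrite !expr0 norm1_eq1.
have [c c0 cE] : exists2 c : R, 0 <= c & c%:C ^+ n.+1 = `|a ^+ n.+1|.
  have [|c c0 cE] := @ge0_complexP _ (n.+1.-root `|a ^+ n.+1|).
    by rewrite rootC_ge0.
  by exists c => //; rewrite -cE rootCK.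
suff : `|l| <= c%:C.
  by rewrite -cE => lc; rewrite lerXn2r ?nnegrE ?normr_ge0 ?ler0c.
rewrite (le_trans lr)// lecR; apply: spectral_radius_le => // m.
move=> /(@spectrumX _ _ n.+1)/spectrum_norm_le.
by rewrite normrX -cE ler_pXn2r ?nnegrE ?normr_ge0 ?ler0c.
Qed.

End BanachAlgebraSpectrum.

(** * The Banach algebra of bounded families *)

Section FunctionAlgebra.
Variables (T : pointedType) (K : pzRingType) (V : algType K).

Let scalerAl k (f g : T -> V) : k *: (f * g) = (k *: f) * g.
Proof. by apply/funext => t; exact: scalerAl. Qed.

Let scalerAr k (f g : T -> V) : k *: (f * g) = f * (k *: g).
Proof. by apply/funext => t; exact: scalerAr. Qed.

HB.instance Definition _ := GRing.Lmodule_isLalgebra.Build K (T -> V) scalerAl.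
HB.instance Definition _ := GRing.Lalgebra_isAlgebra.Build K (T -> V) scalerAr.

End FunctionAlgebra.

Section BoundedFamilies.
Variables (R : realType) (I : pointedType) (A : banachAlgType R[i]).

Definition bounded_family : {pred I -> A} :=
  [pred f : I -> A | `[< exists M, forall i, `|f i| <= M >]].

Lemma bounded_familyP (f : I -> A) :
  reflect (exists M, forall i, `|f i| <= M) (f \in bounded_family).
Proof. exact: asboolP. Qed.

Lemma bounded_family_subalg : GRing.subsemialg_closed bounded_family.
Proof.
split.
- by apply/bounded_familyP; exists 1 => i; rewrite norm1_eq1.
- split.
    by apply/bounded_familyP; exists 0 => i; rewrite normr0.
  move=> f g /bounded_familyP[M fM] /bounded_familyP[N gN].
  apply/bounded_familyP; exists (M + N) => i.
  by rewrite (le_trans (ler_normD _ _))// lerD.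
- move=> k f /bounded_familyP[M fM]; apply/bounded_familyP.
  by exists (`|k| * M) => i; rewrite normrZ ler_wpM2l.
- move=> f g /bounded_familyP[M fM] /bounded_familyP[N gN].
  apply/bounded_familyP; exists (M * N) => i.
  by rewrite (le_trans (normM_le _ _))// ler_pM.
Qed.

Record linfty := Linfty {
  linfty_fun :> I -> A;
  linfty_bounded : linfty_fun \in bounded_family
}.

HB.instance Definition _ := [isSub for linfty_fun].
HB.instance Definition _ := [Choice of linfty by <:].
HB.instance Definition _ := GRing.SubChoice_isSubAlgebra.Build R[i] _
  bounded_family linfty bounded_family_subalg.

Implicit Types f g : linfty.

Definition linfty_norm f : R[i] :=
  (sup (range (fun i => complex.Re `|f i|)))%:C.

Lemma linfty_norm_le f (c : R[i]) :
  (forall i, `|f i| <= c) -> linfty_norm f <= c.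
Proof.
move=> fc; have c0 := le_trans (normr_ge0 _) (fc point).
rewrite -[leRHS](RRe_real (ger0_real c0)) lecR ge_sup//.
  by exists (complex.Re `|f point|); exists point.
move=> _ [i _ <-]; rewrite -lecR !RRe_real ?fc ?normr_real//.
exact: ger0_real.
Qed.

Lemma le_linfty_norm f i : `|f i| <= linfty_norm f.
Proof.
have /bounded_familyP[M fM] := linfty_bounded f.
rewrite -[leLHS](RRe_real (normr_real _)) lecR.
apply: ub_le_sup; last by exists i.
exists (complex.Re M) => _ [j _ <-].
have M0 := le_trans (normr_ge0 _) (fM j).
by rewrite -lecR !RRe_real ?fM ?normr_real// ger0_real.
Qed.

Lemma linfty_norm_ge0 f : 0 <= linfty_norm f.
Proof. exact: le_trans (normr_ge0 _) (le_linfty_norm f point). Qed.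

Lemma linfty_normD f g : linfty_norm (f + g) <= linfty_norm f + linfty_norm g.
Proof.
apply: linfty_norm_le => i.
by rewrite (le_trans (ler_normD _ _))// lerD// le_linfty_norm.
Qed.

(** The reverse inequality is the direct one applied to [k^-1] and [k *: f]. *)
Lemma linfty_normZ (k : R[i]) f : linfty_norm (k *: f) = `|k| * linfty_norm f.
Proof.
have le_normZ (l : R[i]) g : linfty_norm (l *: g) <= `|l| * linfty_norm g.
  apply: linfty_norm_le => i.
  by rewrite (normrZ l (g i)) ler_wpM2l// le_linfty_norm.
apply/eqP; rewrite eq_le le_normZ /=.
have [->|k0] := eqVneq k 0; first by rewrite normr0 mul0r linfty_norm_ge0.
rewrite mulrC -ler_pdivlMr ?normr_gt0// mulrC -normfV.
by rewrite -{1}[f]scale1r -(mulVf k0) -scalerA le_normZ.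
Qed.

Lemma linfty_norm0_eq0 f : linfty_norm f = 0 -> f = 0.
Proof.
move=> f0; apply/val_inj/funext => i; apply/eqP.
by rewrite -normr_le0 -f0 le_linfty_norm.
Qed.

Lemma linfty_normM f g : linfty_norm (f * g) <= linfty_norm f * linfty_norm g.
Proof.
apply: linfty_norm_le => i.
by rewrite (le_trans (normM_le _ _))// ler_pM// le_linfty_norm.
Qed.

Lemma linfty_norm1 : linfty_norm 1 = 1.
Proof.
apply/eqP; rewrite eq_le; apply/andP; split.
  by apply: linfty_norm_le => i; rewrite norm1_eq1.
by rewrite -(norm1_eq1 A) (le_linfty_norm 1 point).
Qed.

HB.instance Definition _ := Algebra_isNormedAlgebra.Build R[i] linfty
  linfty_normD linfty_normZ linfty_norm0_eq0 linfty_normM linfty_norm1.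

(** A Cauchy filter converges at each index, to a family [h].  The convergence
    is uniform in the index: [near_h] compares [h i] with [f i] through
    a [g] near [f] chosen after [i], and the bound obtained does not depend on
    [g]. *)
Lemma linfty_complete : complete_norm linfty.
Proof.
move=> F PF /cauchyP Fc.
have eval_cauchy i : cauchy ((fun f : linfty => f i) @ F).
  apply: cauchy_exP => e e0; have [f fF] := Fc e e0; exists (f i).
  change (\forall g \near F, ball (f i) e ((g : linfty) i)).
  apply: filterS fF => g; rewrite -!ball_normE /=.
  exact: le_lt_trans (le_linfty_norm (f - g) i).
have eval_cvg i : cvg ((fun f : linfty => f i) @ F).
  exact: banach_complete.
pose h i := lim ((fun f : linfty => f i) @ F).
have near_h (e : R[i]) : 0 < e ->
    \forall f \near F, forall i, `|h i - (f : linfty) i| <= e.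
  move=> e0; have [f0 f0F] := Fc _ (divr_gt0 e0 (ltr0n _ 3)).
  apply: filterS (f0F) => f ff0 i.
  have /cvgrPdist_lt/(_ _ (divr_gt0 e0 (ltr0n _ 3))) hi := eval_cvg i.
  have [g [/= hg gf0]] := filter_ex (filterI hi f0F).
  have -> : h i - f i = (h i - g i) - (f0 i - g i) + (f0 i - f i).
    by rewrite opprB !addrA subrK subrK.
  have -> : e = e / 3 + e / 3 + e / 3 by field.
  have ev (f' : linfty) : ball f0 (e / 3) f' -> `|f0 i - f' i| <= e / 3.
    rewrite -ball_normE /= => f0f'.
    exact: le_trans (le_linfty_norm (f0 - f') i) (ltW f0f').
  rewrite (le_trans (ler_normD _ _))// lerD ?ev//.
  by rewrite (le_trans (ler_normB _ _))// lerD ?ev// ltW.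
have hb : h \in bounded_family.
  have [f fh] := filter_ex (near_h 1 ltr01).
  apply/bounded_familyP; exists (1 + linfty_norm f) => i.
  rewrite -[h i](subrK (f i)) (le_trans (ler_normD _ _))//.
  by rewrite lerD// le_linfty_norm.
apply/cvg_ex; exists (Linfty hb); apply/cvgrPdist_le => e e0.
apply: filterS (near_h e e0) => f fh.
exact: (@linfty_norm_le (Linfty hb - f)).
Qed.

HB.instance Definition _ :=
  NormedAlgebra_isBanachAlgebra.Build R[i] linfty linfty_complete.

Lemma linftyX f n i : (f ^+ n) i = f i ^+ n.
Proof. by elim: n => [|n IHn]//; rewrite !exprS -IHn. Qed.

(** Inverses at the separate indices form an inverse family only if that family
    is bounded, whence the uniform [M]. *)
Lemma invertible_linftyP f : invertible f <-> exists M, forall i,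
  exists b, [/\ b * f i = 1, f i * b = 1 & `|b| <= M].
Proof.
split=> [[g [gf fg]]|[M fM]].
  exists (linfty_norm g) => i; exists (g i); split; last exact: le_linfty_norm.
    by have /(congr1 (fun h : linfty => h i)) := gf.
  by have /(congr1 (fun h : linfty => h i)) := fg.
have [g gP] := choice fM.
have gb : g \in bounded_family.
  by apply/bounded_familyP; exists M => i; have [] := gP i.
by exists (Linfty gb); split; apply/val_inj/funext => i; have [] := gP i.
Qed.

End BoundedFamilies.

(** * Adjoining scalars to the spectrum *)

HB.instance Definition _ (T : choiceType) := isPointed.Build (option T) None.

Lemma compact_dist_gt0 (R : realType) (K : set R[i]) (l : R[i]) :
  compact (K : set R[i]^o) -> ~ K l ->
  exists2 d : R[i], 0 < d & forall k, K k -> d <= `|l - k|.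
Proof.
move=> /(compact_closed (@norm_hausdorff _ _)) Kcl Kl.
have : nbhs (l : R[i]^o) (~` K).
  by apply: open_nbhs_nbhs; split=> //; exact: closed_openC.
move=> /nbhs_ballP[d /= d0 dK]; exists d => // k Kk.
rewrite real_leNgt ?normr_real ?gtr0_real//; apply/negP => lkd.
by apply: dK Kk; rewrite -ball_normE.
Qed.

Theorem lemma2p3 (R : realType) (A : banachAlgType R[i]) (x : A)
    (K : set R[i]) (Kcompact : compact (K : set R[i]^o))
    (Kdisc : K `<=` closed_disc 0 (spectral_radius x)) :
  exists (B : banachAlgType R[i]) (y : B),
    (forall n : nat, `|y ^+ n| = `|x ^+ n|) /\
    spectrum y = spectrum x `|` K.
Proof.
have KX (k : R[i]) n : K k -> `|k| ^+ n <= `|x ^+ n|.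
  move=> /Kdisc; rewrite /closed_disc /= subr0.
  exact: expr_spectral_radius_le.
pose y (i : option K) : A := if i is Some k then val k *: 1 else x.
have yX n i : `|y i ^+ n| <= `|x ^+ n|.
  case: i => [k|]//=; rewrite exprZn expr1n normrZ norm1_eq1 mulr1 normrX.
  exact/KX/set_valP.
have yb : y \in @bounded_family R (option K) A.
  by apply/bounded_familyP; exists `|x| => i; have := yX 1%N i.
exists (@linfty R (option K) A), (Linfty yb); split=> [n|].
  apply/eqP; rewrite eq_le; apply/andP; split.
    by apply: linfty_norm_le => i; rewrite linftyX.
  have := le_linfty_norm (Linfty yb ^+ n) None.
  by rewrite linftyX.
apply/seteqP; split=> l.
  move=> ly; apply: contrapT => /not_orP[/contrapT[b0 [b0x xb0]]].
  move=> /(compact_dist_gt0 Kcompact)[d d0 dK]; apply: ly.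
  apply/invertible_linftyP; exists (`|b0| + d^-1) => -[k|].
    have dk := dK _ (set_valP k).
    have lk : l - val k != 0 by rewrite -normr_gt0 (lt_le_trans d0).
    exists ((l - val k)^-1 *: 1).
    have -> : (l *: 1 - Linfty yb) (Some k) = (l - val k) *: 1.
      by rewrite scalerBl.
    split; [by rewrite -scalerAl mul1r scalerA mulVf// scale1r
           |by rewrite -scalerAl mul1r scalerA mulfV// scale1r|].
    rewrite normrZ norm1_eq1 mulr1 normfV ler_wpDl//.
    by rewrite lef_pV2// posrE normr_gt0.
  by exists b0; split; rewrite // lerDl invr_ge0 ltW.
move=> lxK /invertible_linftyP[M inv]; case: lxK => [|Kl].
  by apply; have [b [bx xb _]] := inv None; exists b.
(* The family [l *: 1 - y] vanishes at the index [l]. *)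
have [b [+ _ _]] := inv (Some (SigSub (mem_set Kl))).
rewrite [X in _ * X]subrr mulr0 => /esym/eqP.
by rewrite oner_eq0.
Qed.
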